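(* Consider the case of a single mutable constraint in which only the constraint parameters $a$ and $b$ are mutable. The algorithm described in the context (Algorithm W) calculates an optimal weak counterfactual explanation $(a^*,b^* )\in\mathcal H_{a,b}$ whenever one exists.
   Context: Setting. $\mathcal X\subseteq\mathbb Z_+^n$ is the immutable feasible set (optimization problems over it are assumed solvable by a black-box solver), $\mathcal D\subseteq\mathbb Z_+^n$ is the favored solution space with $\mathcal D\cap\mathcal X\neq\emptyset$, $\hat c\in\mathbb Z^n$ is fixed, and $(\hat a,\hat b)\in\mathcal H_{a,b}$, where $\mathcal H_{a,b}\subseteq\mathbb Z^{n}\times\mathbb Z$ is bounded. The present problem is $\min\{\hat c^\top x:\hat a^\top x\ge\hat b,\ x\in\mathcal X\}$. A weak counterfactual explanation (weak CE) is $(a,b)\in\mathcal H_{a,b}$ with $\mathcal D\cap\operatorname{argmin}\{\hat c^\top x: x\in\mathcal X,\ a^\top x\ge b\}\ne\emptyset$. Its cost is $d(a,b):=\delta((\hat c,a,b),(\hat c,\hat a,\hat b))\ge 0$ for a given distance measure $\delta$; an optimal weak CE is one of minimal cost. Let $(a_{\max})_i=\max_{(a,b)\in\mathcal H_{a,b}}a_i$ and $b_{\min}=\min_{(a,b)\in\mathcal H_{a,b}}b$, and let $\underline c$ and $\bar c$ be, respectively, the minimum and maximum of $\hat c^\top x$ over $\{x\in\mathcal D\cap\mathcal X: a_{\max}^\top x\ge b_{\min}\}$. For $v\in\mathbb Z$ define the master problem $$(\mathrm{MP}_v)\quad \min_{a,b,x}\ d(a,b)\ \text{ s.t. }\ a^\top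 y\le b-1\ \ \forall y\in\mathcal X \text{ with } \hat c^\top y\le v-1,\ \ \hat c^\top x=v,\ \ a^\top x\ge b,\ \ x\in\mathcal D\cap\mathcal X,\ \ (a,b)\in\mathcal H_{a,b},$$ and the lower-bound problem $$(\mathrm{LB}_v)\quad \min_{a,b}\ d(a,b)\ \text{ s.t. }\ a^\top y\le b-1\ \ \forall y\in\mathcal X \text{ with } \hat c^\top y\le v-1,\ \ (a,b)\in\mathcal H_{a,b}.$$ An infeasible problem has optimal value $+\infty$. Subroutine M (input $v$ and known upper bound $d^*$). Set $\mathcal Y=\emptyset$. Repeat: compute an optimal solution $(\tilde a,\tilde b)$ of the problem obtained from $(\mathrm{MP}_v)$ by imposing $a^\top y\le b-1$ only for $y\in\mathcal Y$ and adding the constraint $d(a,b)\le d^*$; if infeasible, stop and return ''infeasible''. Otherwise compute an optimal solution $\tilde y$ of $\max\{\tilde a^\top y:\hat c^\top y\le v-1,\ y\in\mathcal X\}$. If $\tilde a^\top\tilde y\ge\tilde b$, add $\tilde y$ to $\mathcal Y$ and repeat; else (also if the separation problem is infeasible) return $(\tilde a,\tilde b)$. Algorithm W. Set $(a^*,b^* )=\emptyset$ and $d^*=\infty$. For $v=\underline c,\underline c+1,\ldots,\bar c$: let $lb$ be the optimal value of $(\mathrm{LB}_v)$. If $lb\ge d^*$, stop and return $(a^*,b^* )$. Otherwise run Subroutine M with input $v,d^*$; if it returns a pair $(a^*(v),b^*(v))$ with $d(a^*(v),b^*(v))<d^*$, set $(a^*,b^* )\leftarrow(a^*(v),b^*(v))$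 and $d^*\leftarrow d(a^*(v),b^*(v))$. After the loop, return $(a^*,b^* )$. *)

(* Defs.v *)
From Stdlib Require Export Relation_Operators.
From mathcomp Require Export all_boot all_order all_algebra.
From mathcomp Require Export boolp classical_sets reals ereal.

Set Implicit Arguments.
Unset Strict Implicit.
Unset Printing Implicit Defensive.

Import Order.TTheory GRing.Theory Num.Theory.

Local Open Scope classical_set_scope.
Local Open Scope ring_scope.

Definition dotp n (a x : 'cV[int]_n) : int := (a^T *m x) 0 0.

Definition argmin disp (V : porderType disp) T (f : T -> V) (S : set T) :
  set T := [set x | S x /\ forall y, S y -> (f x <= f y)%O].

Definition argmax disp (V : porderType disp) T (f : T -> V) (S : set T) :
  set T := [set x | S x /\ forall y, S y -> (f y <= f x)%O].

Definition is_min (A : set int) (m : int) : Prop := A m /\ lbound A m.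
Definition is_max (A : set int) (m : int) : Prop := A m /\ ubound A m.

Definition nonneg_set n (S : set 'cV[int]_n) : Prop :=
  forall x, S x -> forall i, 0 <= x i 0.

Definition bounded_params n (H : set ('cV[int]_n * int)) : Prop :=
  exists M : int, forall p, H p -> (forall i, `|p.1 i 0| <= M) /\ `|p.2| <= M.

Definition cost (R : realType) n
    (delta : 'cV[int]_n * 'cV[int]_n * int ->
             'cV[int]_n * 'cV[int]_n * int -> R)
    (c a0 : 'cV[int]_n) (b0 : int) (p : 'cV[int]_n * int) : R :=
  delta (c, p.1, p.2) (c, a0, b0).

Definition weak_CE n (X D : set 'cV[int]_n) (H : set ('cV[int]_n * int))
    (c : 'cV[int]_n) : set ('cV[int]_n * int) :=
  [set p | H p /\
     D `&` argmin (dotp c) [set x | X x /\ p.2 <= dotp p.1 x] !=set0].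

Definition optimal_weak_CE (R : realType) n (X D : set 'cV[int]_n)
    (H : set ('cV[int]_n * int)) (c : 'cV[int]_n)
    (d : 'cV[int]_n * int -> R) : set ('cV[int]_n * int) :=
  argmin d (weak_CE X D H c).

Definition cheaper n (X : set 'cV[int]_n) (c : 'cV[int]_n) (v : int) :
  set 'cV[int]_n := [set y | X y /\ dotp c y <= v - 1].

(* For [Y = cheaper X c v] this is the feasible set of (MP_v); the triple
   [(a, b, x)] is encoded as [(p, x)] with [p = (a, b)]. *)
Definition master_feasible n (X D : set 'cV[int]_n)
    (H : set ('cV[int]_n * int)) (c : 'cV[int]_n) (v : int)
    (Y : set 'cV[int]_n) : set (('cV[int]_n * int) * 'cV[int]_n) :=
  [set q | [/\ forall y, Y y -> dotp q.1.1 y <= q.1.2 - 1,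
               dotp c q.2 = v,
               q.1.2 <= dotp q.1.1 q.2,
               (D `&` X) q.2
             & H q.1]].

Definition restricted_master (R : realType) n (X D : set 'cV[int]_n)
    (H : set ('cV[int]_n * int)) (c : 'cV[int]_n)
    (d : 'cV[int]_n * int -> R) (v : int) (Y : set 'cV[int]_n)
    (dstar : \bar R) : set (('cV[int]_n * int) * 'cV[int]_n) :=
  [set q | master_feasible X D H c v Y q /\ ((d q.1)%:E <= dstar)%E].

Definition LB_feasible n (X : set 'cV[int]_n) (H : set ('cV[int]_n * int))
    (c : 'cV[int]_n) (v : int) : set ('cV[int]_n * int) :=
  [set p | (forall y, cheaper X c v y -> dotp p.1 y <= p.2 - 1) /\ H p].

(* [ereal_inf set0 = +oo], the value of an infeasible problem. *)
Definition LB_value (R : realType) n (X : set 'cV[int]_n)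
    (H : set ('cV[int]_n * int)) (c : 'cV[int]_n)
    (d : 'cV[int]_n * int -> R) (v : int) : \bar R :=
  ereal_inf [set (d p)%:E | p in LB_feasible X H c v].

(* Control states of Algorithm W with Subroutine M inlined.  [best] and
   [dstar] are the incumbent and its cost, [Y] the cuts generated so far by
   the current call of M, and [r] the result of that call ([None] means
   "infeasible"). *)
Inductive state (R : realType) (n : nat) : Type :=
| Loop (v : int) (best : option ('cV[int]_n * int)) (dstar : \bar R)
| Master (v : int) (Y : set 'cV[int]_n)
    (best : option ('cV[int]_n * int)) (dstar : \bar R)
| Separate (v : int) (Y : set 'cV[int]_n) (p : 'cV[int]_n * int)
    (best : option ('cV[int]_n * int)) (dstar : \bar R)
| Update (v : int) (r : option ('cV[int]_n * int))
    (best : option ('cV[int]_n * int)) (dstar : \bar R)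
| Return (best : option ('cV[int]_n * int)).

Arguments Loop {R n}.
Arguments Master {R n}.
Arguments Separate {R n}.
Arguments Update {R n}.
Arguments Return {R n}.

(* The relation is nondeterministic because a solver may return any optimal
   solution. *)
Inductive step (R : realType) n (X D : set 'cV[int]_n)
    (H : set ('cV[int]_n * int)) (c : 'cV[int]_n)
    (d : 'cV[int]_n * int -> R) (chi : int) : state R n -> state R n -> Prop :=
| step_exhausted v best dstar :
    chi < v ->
    step X D H c d chi (Loop v best dstar) (Return best)
| step_cutoff v best dstar :
    v <= chi -> (dstar <= LB_value X H c d v)%E ->
    step X D H c d chi (Loop v best dstar) (Return best)
| step_call v best dstar :
    v <= chi -> (LB_value X H c d v < dstar)%E ->
    step X D H c d chi (Loop v best dstar) (Master v set0 best dstar)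
| step_master_infeasible v Y best dstar :
    restricted_master X D H c d v Y dstar = set0 ->
    step X D H c d chi (Master v Y best dstar) (Update v None best dstar)
| step_master_optimal v Y best dstar p x :
    argmin (fun q => d q.1) (restricted_master X D H c d v Y dstar) (p, x) ->
    step X D H c d chi (Master v Y best dstar) (Separate v Y p best dstar)
| step_separate_cut v Y p best dstar y :
    argmax (dotp p.1) (cheaper X c v) y -> p.2 <= dotp p.1 y ->
    step X D H c d chi (Separate v Y p best dstar)
      (Master v (Y `|` [set y]) best dstar)
| step_separate_none v Y p best dstar y :
    argmax (dotp p.1) (cheaper X c v) y -> dotp p.1 y < p.2 ->
    step X D H c d chi (Separate v Y p best dstar)
      (Update v (Some p) best dstar)
| step_separate_infeasible v Y p best dstar :
    cheaper X c v = set0 ->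
    step X D H c d chi (Separate v Y p best dstar)
      (Update v (Some p) best dstar)
| step_improve v p best dstar :
    ((d p)%:E < dstar)%E ->
    step X D H c d chi (Update v (Some p) best dstar)
      (Loop (v + 1) (Some p) (d p)%:E)
| step_keep v p best dstar :
    (dstar <= (d p)%:E)%E ->
    step X D H c d chi (Update v (Some p) best dstar)
      (Loop (v + 1) best dstar)
| step_infeasible v best dstar :
    step X D H c d chi (Update v None best dstar) (Loop (v + 1) best dstar).

Definition initial (R : realType) n (clo : int) : state R n :=
  Loop clo None +oo%E.

(* Total correctness for nondeterministic runs: no run is infinite, and every
   maximal run ends by returning a pair satisfying [post]. *)
Definition algorithm_W_computes (R : realType) n (X D : set 'cV[int]_n)
    (H : set ('cV[int]_n * int)) (c : 'cV[int]_n)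
    (d : 'cV[int]_n * int -> R) (clo chi : int)
    (post : set ('cV[int]_n * int)) : Prop :=
  Acc (fun s' s => step X D H c d chi s s') (initial R n clo) /\
  forall s, clos_refl_trans (state R n) (step X D H c d chi)
              (initial R n clo) s ->
    (forall s', ~ step X D H c d chi s s') ->
    exists2 p, s = Return (Some p) & post p.

(* Main.v *)
(** Every weak CE [p] whose favored solution has value [v] is feasible for
    (MP_v), and conversely; moreover [clo <= v <= chi] because [x >= 0] gives
    [bmin <= p.2 <= p.1^T x <= amax^T x].  So scanning the values [v] scans all
    weak CEs.  A relaxed master optimum that violates no cut is optimal for
    (MP_v).  As the cuts of (LB_v) get stronger with [v], the bound [lb] is also
    valid for all later values, which justifies the cutoff.  Each generated cut
    excludes the current pair [p], and [H] is finite, so Subroutine M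
    terminates. *)
Require Import Defs.
From mathcomp Require Import zify.

Set Implicit Arguments.
Unset Strict Implicit.
Unset Printing Implicit Defensive.

Import Order.TTheory GRing.Theory Num.Theory.
Local Open Scope classical_set_scope.
Local Open Scope ring_scope.

(** * Finite parameter sets and minima over them *)

Lemma lez_sub1 (m n : int) : (m <= n - 1) = (m < n).
Proof. by lia. Qed.

Lemma dotpE n (a x : 'cV[int]_n) : dotp a x = \sum_i a i 0 * x i 0.
Proof. by rewrite /dotp !mxE; apply: eq_bigr => i _; rewrite mxE. Qed.

Lemma dotp_le n (a b x : 'cV[int]_n) :
  (forall i, 0 <= x i 0) -> (forall i, a i 0 <= b i 0) -> dotp a x <= dotp b x.
Proof.
by move=> x_ge0 ab; rewrite !dotpE; apply: ler_sum => i _; rewrite ler_wpM2r.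
Qed.

(** Shifting by [M] codes the entries as ordinals, so a finite type enumerates the whole box of
    radius [M]. *)
Lemma bounded_params_seq n (H : set ('cV[int]_n * int)) :
  bounded_params H -> exists s : seq ('cV[int]_n * int), {subset H <= s}.
Proof.
case=> M HM; pose K := (2 * absz M)%N.
pose f (k : 'I_K.+1) : int := k%:Z - M.
pose g (z : int) : 'I_K.+1 := inord (absz (z + M)).
have fK z : `|z| <= M -> f (g z) = z.
  move=> zM; rewrite /f /g inordK; last by rewrite /K; lia.
  by lia.
exists [seq (map_mx f q.1, f q.2) | q : 'cV['I_K.+1]_n * 'I_K.+1].
move=> p /set_mem /HM[p1M p2M]; apply/mapP.
exists (map_mx g p.1, g p.2); rewrite ?mem_enum //= fK //.
case: p p1M {p2M} => a b /= aM; congr pair; apply/colP => i.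
by rewrite !mxE fK.
Qed.

Lemma size_filter_predC1 (T : eqType) (s : seq T) (x : T) :
  x \in s -> (size [seq u <- s | u != x] < size s)%N.
Proof.
move=> xs; rewrite size_filter -(count_predC (pred1 x) s).
by rewrite -[X in (X < _)%N]add0n ltn_add2r -has_count has_pred1.
Qed.

(** [A] may be infinite; only the values of [g] are confined to a list. If [x] is not minimal, the
    images of the strictly better elements avoid [g x], so the list can be shortened. *)
Lemma argmin_finite disp (V : orderType disp) (T : Type) (U : eqType)
    (g : T -> U) (f : U -> V) (s : seq U) (A : set T) :
  (forall x, A x -> g x \in s) -> A !=set0 ->
  argmin (fun x => f (g x)) A !=set0.
Proof.
have [k] := ubnP (size s); elim: k => // k IH in s A *.
rewrite ltnS => sk As [x Ax].
have [xmin|/existsNP[y /not_implyP[Ay /negP]]] :=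
  EM (forall y, A y -> (f (g x) <= f (g y))%O); first by exists x.
rewrite -ltNge => yx.
have [] := IH [seq u <- s | u != g x]
  [set z | A z /\ (f (g z) < f (g x))%O].
- exact: leq_trans (size_filter_predC1 (As x Ax)) sk.
- move=> z [Az zx]; rewrite mem_filter As // andbT.
  by apply: contraTN zx => /eqP ->; rewrite ltxx.
- by exists y.
move=> z [[Az zx] zmin]; exists z; split=> // t At.
have [tx|xt] := ltP (f (g t)) (f (g x)); first exact: zmin.
exact: le_trans (ltW zx) xt.
Qed.

Section AlgorithmW.
Context (R : realType) (n : nat) (X D : set 'cV[int]_n)
  (H : set ('cV[int]_n * int)) (c : 'cV[int]_n)
  (d : 'cV[int]_n * int -> R) (clo chi : int).

(** * Weak CEs as feasible points of the master problems *)

Local Notation feasible v :=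
  (master_feasible X D H c v (cheaper X c v)).

Lemma master_feasible_weak_CE v q : feasible v q -> weak_CE X D H c q.1.
Proof.
move=> [cuts xv bx [Dx Xx] Hq]; split=> //; exists q.2; split=> //.
split=> // y [Xy by_]; rewrite leNgt xv; apply/negP => yv.
have /cuts : cheaper X c v y by split=> //; lia.
by rewrite lez_sub1 ltNge by_.
Qed.

(** The witness is the favored minimizer: a cheaper point cannot satisfy the mutable constraint, and
    integrality turns this into a cut. *)
Lemma weak_CE_master_feasible p :
  weak_CE X D H c p -> exists x, feasible (dotp c x) (p, x).
Proof.
move=> [Hp [x [Dx [[Xx bx] xmin]]]]; exists x; split=> // y [Xy yv].
have [//|py] := leP (dotp p.1 y) (p.2 - 1).
have /xmin : X y /\ p.2 <= dotp p.1 y by split=> //; lia.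
by move=> ?; lia.
Qed.

Lemma master_feasible_sub v (Y Z : set 'cV[int]_n) :
  Y `<=` Z ->
  master_feasible X D H c v Z `<=` master_feasible X D H c v Y.
Proof. by move=> YZ q [cuts xv bx DXx Hq]; split=> // y /YZ/cuts. Qed.

(** The cuts of (LB_v) are among those of (MP_w), and (LB_v) has no constraint on [x]. *)
Lemma LB_value_le v w q :
  v <= w -> feasible w q -> (LB_value X H c d v <= (d q.1)%:E)%E.
Proof.
move=> vw [cuts _ _ _ Hq]; apply: ereal_inf_lbound; exists q.1 => //.
by split=> // y [Xy yv]; apply: cuts; split=> //; lia.
Qed.

Lemma weak_CE_value_range (amax : 'cV[int]_n) (bmin : int) v q :
  nonneg_set X ->
  (forall i, is_max [set p.1 i 0 | p in H] (amax i 0)) ->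
  is_min [set p.2 | p in H] bmin ->
  is_min [set dotp c x | x in
    [set x | (D `&` X) x /\ bmin <= dotp amax x]] clo ->
  is_max [set dotp c x | x in
    [set x | (D `&` X) x /\ bmin <= dotp amax x]] chi ->
  feasible v q -> clo <= v <= chi.
Proof.
move=> X_ge0 amaxP [_ bminP] [_ cloP] [_ chiP] [_ xv bx DXx Hq].
have xin : [set dotp c x | x in
    [set x | (D `&` X) x /\ bmin <= dotp amax x]] v.
  exists q.2 => //; split=> //.
  apply: (@le_trans _ _ q.1.2); first by apply: bminP; exists q.1.
  apply: le_trans bx _; apply: dotp_le => [|i]; first exact: X_ge0 DXx.2.
  by have [_] := amaxP i; apply; exists q.1.
by apply/andP; split; [exact: cloP|exact: chiP].
Qed.

(** * The invariant of the control states *)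

Definition incumbent (v : int) (best : option ('cV[int]_n * int))
    (dstar : \bar R) : Prop :=
  (if best is Some p then weak_CE X D H c p /\ dstar = (d p)%:E
   else dstar = +oo%E) /\
  forall (w : int) q, w < v -> feasible w q -> (dstar <= (d q.1)%:E)%E.

(** At [Update], only solutions of cost at most [dstar] are compared, since Subroutine M imposes
    this bound; [None] then means that (MP_v) has no such solution. *)
Definition invariant (s : state R n) : Prop :=
  match s with
  | Loop v best dstar => clo <= v /\ incumbent v best dstar
  | Master v Y best dstar =>
      [/\ clo <= v <= chi, Y `<=` cheaper X c v & incumbent v best dstar]
  | Separate v Y p best dstar =>
      [/\ clo <= v <= chi, Y `<=` cheaper X c v, incumbent v best dstar &
          exists x, argmin (fun q => d q.1)
            (restricted_master X D H c d v Y dstar) (p, x)]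
  | Update v r best dstar =>
      [/\ clo <= v <= chi, incumbent v best dstar,
          (if r is Some p then weak_CE X D H c p else True) &
          forall q, feasible v q -> ((d q.1)%:E <= dstar)%E ->
            exists2 p, r = Some p & d p <= d q.1]
  | Return best =>
      exists2 p, best = Some p & optimal_weak_CE X D H c d p
  end.

(** Serves both exits of the loop. A weak CE has finite cost, which rules out an empty incumbent
    with infinite [dstar]. *)
Lemma incumbent_optimal best dstar :
  weak_CE X D H c !=set0 ->
  (if best is Some p then weak_CE X D H c p /\ dstar = (d p)%:E
   else dstar = +oo%E) ->
  (forall w q, feasible w q -> (dstar <= (d q.1)%:E)%E) ->
  exists2 p, best = Some p & optimal_weak_CE X D H c d p.
Proof.
move=> [p0 /weak_CE_master_feasible[x0 fx0]].
case: best => [p [CEp ->]|-> /(_ _ _ fx0)//] dle; exists p => //; split=> //.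
by move=> q /weak_CE_master_feasible[x /dle]; rewrite lee_fin.
Qed.

Lemma master_optimal_uncut v Y p best dstar :
  invariant (Separate v Y p best dstar) ->
  (forall y, cheaper X c v y -> dotp p.1 y < p.2) ->
  invariant (Update v (Some p) best dstar).
Proof.
move=> [vr YX inc [x [[[_ xv bx DXx Hp] _] pmin]]] cuts; split=> //.
  apply: (@master_feasible_weak_CE v (p, x)); split=> // y /cuts.
  by rewrite lez_sub1.
move=> q /(master_feasible_sub YX) fq dq; exists p => //.
exact: (pmin q).
Qed.

Lemma incumbent_next v r best dstar best' dstar' :
  invariant (Update v r best dstar) ->
  step X D H c d chi (Update v r best dstar) (Loop (v + 1) best' dstar') ->
  incumbent (v + 1) best' dstar'.
Proof.
move=> [_ [bestP dle] rP optr] st.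
(* A new bound not above [dstar] stays valid for values below [v], so only [v] itself has to be
   checked. *)
have bound ds : (ds <= dstar)%E ->
    (forall q, feasible v q -> (ds <= (d q.1)%:E)%E) ->
    forall w q, w < v + 1 -> feasible w q -> (ds <= (d q.1)%:E)%E.
  move=> dsd dsv w q wv fq; have [wltv|vw] := ltP w v.
    exact: le_trans dsd (dle w q wltv fq).
  by have wE : w = v by [lia]; subst w; exact: dsv.
inversion st as [| | | | | | | |? p ? ? dp|? p ? ? dp|]; subst.
- split=> //; apply: bound => [|q fq]; first exact: ltW.
  (* Either [q] respects the old bound and competes with [p], or it costs more than [dstar], hence
     more than [p]. *)
  have [dq|/ltW dq] := leP (d q.1)%:E%E dstar.
    by have [_ [<-]] := optr q fq dq; rewrite lee_fin.
  by apply: le_trans dq; exact: ltW.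
- split=> //; apply: bound => [|q fq]; first exact: lexx.
  (* A [q] below the old bound would force [p] below it too, so the incumbent would not have been
     kept. *)
  have [//|dq] := leP dstar' (d q.1)%:E%E.
  have [_ [<-]] := optr q fq (ltW dq); rewrite -lee_fin => pq.
  by have := le_lt_trans (le_trans dp pq) dq; rewrite ltxx.
- split=> //; apply: bound => [|q fq]; first exact: lexx.
  have [//|dq] := leP dstar' (d q.1)%:E%E.
  by have [] := optr q fq (ltW dq).
Qed.

Hypothesis weak_CE_exists : weak_CE X D H c !=set0.
Hypothesis value_range : forall v q, feasible v q -> clo <= v <= chi.

Lemma step_invariant s s' :
  step X D H c d chi s s' -> invariant s -> invariant s'.
Proof.
(* A copy of the step survives the case analysis, for use by [incumbent_next]. *)
move=> st; case: st (st).
- move=> v best ds chiv _ [_ [bestP dle]]; apply: incumbent_optimal bestP _ => //.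
  (* Here [w <= chi < v], so every feasible value has been scanned. *)
  move=> w q fq; apply: dle (fq); have := value_range fq; lia.
- move=> v best ds vchi dlb _ [_ [bestP dle]].
  apply: incumbent_optimal bestP _ => // w q fq.
  (* Scanned values are covered by the incumbent, all later ones by the cutoff. *)
  have [wv|vw] := ltP w v; first exact: dle wv fq.
  exact: le_trans dlb (LB_value_le vw fq).
- by move=> v best ds vchi _ _ [clov inc]; split=> //; rewrite clov.
- move=> v Y best ds rm0 _ [vr YX inc]; split=> // q fq dq.
  have : restricted_master X D H c d v Y ds q.
    by split=> //; exact: master_feasible_sub fq.
  by rewrite rm0.
- by move=> v Y best ds p x opt _ [vr YX inc]; split=> //; exists x.
- move=> v Y p best ds y [cy _] _ _ [vr YX inc _]; split=> //.
  by move=> z [/YX//|->].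
- move=> v Y p best ds y [_ ymax] py _ inv.
  apply: master_optimal_uncut inv _ => z /ymax zy.
  exact: le_lt_trans zy py.
- move=> v Y p best ds c0 _ inv.
  by apply: master_optimal_uncut inv _; rewrite c0.
- move=> v p best ds _ st inv; split; last exact: incumbent_next inv st.
  by case: inv; lia.
- move=> v p best ds _ st inv; split; last exact: incumbent_next inv st.
  by case: inv; lia.
- move=> v best ds st inv; split; last exact: incumbent_next inv st.
  by case: inv; lia.
Qed.

(** * Progress: only [Return] states are stuck *)

Variable s : seq ('cV[int]_n * int).
Hypothesis H_finite : {subset H <= s}.
Hypothesis separation_solvable : forall p (v : int), H p ->
  clo <= v <= chi -> cheaper X c v !=set0 ->
  argmax (dotp p.1) (cheaper X c v) !=set0.

Lemma invariant_progress t :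
  invariant t -> (forall t', ~ step X D H c d chi t t') ->
  exists2 p, t = Return (Some p) & optimal_weak_CE X D H c d p.
Proof.
case: t => /= [v best ds|v Y best ds|v Y p best ds|v [p|] best ds|best].
- move=> _ stuck; exfalso; have [vchi|chiv] := leP v chi; last first.
    by apply: stuck; exact: step_exhausted chiv.
  have [dl|ld] := leP ds (LB_value X H c d v).
    by apply: stuck; exact: step_cutoff dl.
  by apply: stuck; exact: step_call ld.
- move=> _ stuck; exfalso.
  have [/eqP rm0|/set0P rm0] :=
    boolP (restricted_master X D H c d v Y ds == set0).
    by apply: stuck; exact: step_master_infeasible rm0.
  (* The minimum is attained although [x] may range over an infinite set: the cost sees only the
     pair in [H]. *)
  have [] := argmin_finite (g := fst) d (s := s) _ rm0.
    by move=> q [[_ _ _ _ Hq] _]; apply: H_finite; exact: mem_set.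
  by move=> [p x] opt; apply: stuck; exact: step_master_optimal opt.
- move=> [vr _ _ [x [[[_ _ _ _ /= Hp] _] _]]] stuck; exfalso.
  have [/eqP c0|/set0P c0] := boolP (cheaper X c v == set0).
    by apply: stuck; exact: step_separate_infeasible c0.
  have [y ymax] := separation_solvable Hp vr c0.
  have [py|py] := leP p.2 (dotp p.1 y).
    by apply: stuck; exact: step_separate_cut ymax py.
  by apply: stuck; exact: step_separate_none ymax py.
- move=> _ stuck; exfalso; have [dp|dp] := leP ds (d p)%:E%E.
    by apply: stuck; exact: step_keep dp.
  by apply: stuck; exact: step_improve dp.
- by move=> _ stuck; exfalso; apply: stuck; exact: step_infeasible.
- by move=> [p -> ?] _; exists p.
Qed.

(** * Termination and total correctness *)

Local Notation terminates :=
  (Acc (fun t' t => step X D H c d chi t t')).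

Lemma return_terminates best : terminates (Return best).
Proof. by constructor=> t st; inversion st. Qed.

Lemma update_terminates v r best dstar :
  (forall best' dstar', terminates (Loop (v + 1) best' dstar')) ->
  terminates (Update v r best dstar).
Proof. by move=> IH; constructor=> t st; inversion st; subst. Qed.

(** The measure is the length of a list [l] containing all pairs of [H] that satisfy the current
    cuts, initially [s]. *)
Lemma master_terminates v Y best dstar :
  (forall best' dstar', terminates (Loop (v + 1) best' dstar')) ->
  terminates (Master v Y best dstar).
Proof.
move=> IHv.
have [l Yl] : exists l : seq ('cV[int]_n * int), forall p, H p ->
    (forall y, Y y -> dotp p.1 y <= p.2 - 1) -> p \in l.
  by exists s => p Hp _; apply: H_finite; exact: mem_set.
have [k] := ubnP (size l); elim: k => [|k IH] in l Y Yl *; first by rewrite ltn0.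
rewrite ltnS => lk; constructor=> t st.
inversion st as [| | | |? ? ? ? p x opt| | | | | |]; subst.
  exact: update_terminates.
constructor=> t {}st.
inversion st as [| | | | |? ? ? ? ? y _ py| | | | |]; subst;
  try exact: update_terminates.
case: opt => -[[/= cuts _ _ _ Hp] _] _.
apply: (IH [seq u <- l | u != p]).
  move=> q Hq cutsq; rewrite mem_filter Yl ?andbT //; last first.
    by move=> z Yz; apply: cutsq; left.
  (* The new cut at [y] excludes [p], because [p.2 <= dotp p.1 y]. *)
  apply/eqP => qp; have := cutsq y; rewrite qp => /(_ (or_intror erefl)).
  by rewrite lez_sub1 ltNge py.
exact: leq_trans (size_filter_predC1 (Yl p Hp cuts)) lk.
Qed.

Lemma loop_terminates v best dstar : terminates (Loop v best dstar).
Proof.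
(* This counts the values left to scan; truncation at 0 covers [v] beyond [chi]. *)
have [k] := ubnP (absz (Num.max 0 (chi + 1 - v))).
elim: k => [|k IH] in v best dstar *; first by rewrite ltn0.
rewrite ltnS => vk.
constructor=> t st; inversion st; subst; try exact: return_terminates.
by apply: master_terminates => best' dstar'; apply: IH; lia.
Qed.

Lemma algorithm_W_optimal :
  algorithm_W_computes X D H c d clo chi (optimal_weak_CE X D H c d).
Proof.
split; first exact: loop_terminates.
move=> t run; apply: invariant_progress.
have : invariant (initial R n clo).
  (* No feasible value lies below [clo], so the initial infinite bound is vacuously valid. *)
  by split=> //; split=> // w q wclo /value_range; lia.
elim: run => {t} [t t'|//|t1 t2 t3 _ IH1 _ IH2 /IH1/IH2//].
exact: step_invariant.
Qed.

End AlgorithmW.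

(** [separation_solvable] expresses the black-box solver: a feasible separation problem attains its
    maximum. *)
Theorem theorem7 (R : realType) (n : nat)
  (X D : set 'cV[int]_n) (H : set ('cV[int]_n * int))
  (c a0 : 'cV[int]_n) (b0 : int)
  (delta : 'cV[int]_n * 'cV[int]_n * int ->
           'cV[int]_n * 'cV[int]_n * int -> R)
  (amax : 'cV[int]_n) (bmin clo chi : int)
  (X_ge0 : nonneg_set X) (D_ge0 : nonneg_set D)
  (DX_neq0 : D `&` X !=set0)
  (H_bounded : bounded_params H) (H_present : H (a0, b0))
  (cost_ge0 : forall p, 0 <= cost delta c a0 b0 p)
  (amaxP : forall i, is_max [set p.1 i 0 | p in H] (amax i 0))
  (bminP : is_min [set p.2 | p in H] bmin)
  (cloP : is_min
     [set dotp c x | x in [set x | (D `&` X) x /\ bmin <= dotp amax x]] clo)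
  (chiP : is_max
     [set dotp c x | x in [set x | (D `&` X) x /\ bmin <= dotp amax x]] chi)
  (separation_solvable : forall p (v : int), H p -> clo <= v <= chi ->
     cheaper X c v !=set0 ->
     argmax (dotp p.1) (cheaper X c v) !=set0)
  (weak_CE_exists : weak_CE X D H c !=set0) :
  algorithm_W_computes X D H c (cost delta c a0 b0) clo chi
    (optimal_weak_CE X D H c (cost delta c a0 b0)).
Proof.
have [s Hs] := bounded_params_seq H_bounded.
apply: algorithm_W_optimal Hs separation_solvable => // v q.
exact: weak_CE_value_range amaxP bminP cloP chiP.
Qed.
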